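(* Let $\boldsymbol k$ be an algebraically closed field with $\operatorname{char}\boldsymbol k\neq 2$, let $V$ be a vector space over $\boldsymbol k$ of finite dimension $n$, let $\mathcal M:=V^*\otimes V^*\otimes V$, and let $G:=\mathrm{GL}(V)$ act naturally on $\mathcal M$. Then there exist two finite sets $\{s_p\}_{p\in P}$ and $\{t_q\}_{q\in Q}$ of nonconstant polynomial functions on $\mathcal M$ such that: (i) the closed subset $\mathcal S:=\{m\in\mathcal M\mid s_p(m)=0\ \forall p\in P\}$ is irreducible, and the map $\boldsymbol k(\mathcal M)^G\to\boldsymbol k(\mathcal S)$, $f\mapsto f|_{\mathcal S}$, is well defined and is a $\boldsymbol k$-isomorphism of fields; (ii) for every point $a$ of the open dense subset $\{m\in\mathcal M\mid t_q(m)\neq 0\ \forall q\in Q\}$ of $\mathcal M$ there exists a unique element $g\in G$ with $g\cdot a\in\mathcal S$.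
   Context: $\boldsymbol k(\mathcal M)^G$ denotes the field of $G$-invariant rational functions on $\mathcal M$, and $\boldsymbol k(\mathcal S)$ the field of rational functions on the irreducible variety $\mathcal S$. Topology is the Zariski topology. *)

(* Defs.v *)
From mathcomp Require Import all_boot all_order all_algebra.
From mathcomp Require Import mpoly.

Set Implicit Arguments.
Unset Strict Implicit.
Unset Printing Implicit Defensive.

Import GRing.Theory.
Local Open Scope ring_scope.

(* V = k^n with standard basis e_0..e_{n-1}.  A point m of
   M = V^* (x) V^* (x) V is a bilinear map V x V -> V, recorded by its
   coordinates:  m(e_i, e_j) = \sum_l (tens m i j l) e_l. *)
Record tensM (k : fieldType) (n : nat) := TensM { tens : 'I_n -> 'I_n -> 'I_n -> k }.

Definition idxM (n : nat) : finType := ('I_n * 'I_n * 'I_n)%type.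
Definition dimM (n : nat) : nat := #|@predT (idxM n)|.

Definition polyM (k : fieldType) (n : nat) := {mpoly k[dimM n]}.

Definition coordM (k : fieldType) (n : nat) (m : tensM k n) : 'I_(dimM n) -> k :=
  fun i => let x := @enum_val (idxM n) predT i in tens m x.1.1 x.1.2 x.2.

Definition evM (k : fieldType) (n : nat) (p : polyM k n) (m : tensM k n) : k :=
  p.@[coordM m].

(* natural action of GL(V) on V^* (x) V^* (x) V:
   (g.m)(u, v) = g (m (g^-1 u, g^-1 v)), i.e.
   (g.m)_{ij}^l = \sum_{a,b,c} g_{lc} m_{ab}^c (g^-1)_{ai} (g^-1)_{bj}. *)
Definition actM (k : fieldType) (n : nat) (g : 'M[k]_n) (m : tensM k n) : tensM k n :=
  TensM (fun i j l => \sum_(a < n) \sum_(b < n) \sum_(c < n)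
          g l c * tens m a b c * (invmx g) a i * (invmx g) b j).

Definition zero_locus (k : fieldType) (n : nat) (F : polyM k n -> Prop)
  : tensM k n -> Prop := fun m => forall p, F p -> evM p m = 0.

Definition zclosed (k : fieldType) (n : nat) (Z : tensM k n -> Prop) : Prop :=
  exists F : polyM k n -> Prop, forall m, Z m <-> zero_locus F m.

Definition zirreducible (k : fieldType) (n : nat) (X : tensM k n -> Prop) : Prop :=
  (exists m, X m) /\
  forall Z1 Z2 : tensM k n -> Prop, zclosed Z1 -> zclosed Z2 ->
    (forall m, X m -> Z1 m \/ Z2 m) ->
    (forall m, X m -> Z1 m) \/ (forall m, X m -> Z2 m).

Definition zdense (k : fieldType) (n : nat) (U : tensM k n -> Prop) : Prop :=
  forall Z : tensM k n -> Prop, zclosed Z -> (forall m, U m -> Z m) -> forall m, Z m.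

Definition nonconstant (k : fieldType) (n : nat) (p : polyM k n) : Prop :=
  forall c : k, p <> c%:MP.

(* Rational functions on a closed irreducible set X (X = M gives k(M)):
   a rational function is a fraction p/q with q not identically zero on X;
   fractions are identified when p q' - p' q vanishes on X.  This is the
   function field k(X) = Frac(k[M]/I(X)). *)
Definition ratfun (k : fieldType) (n : nat) := (polyM k n * polyM k n)%type.

Definition rat_ok (k : fieldType) (n : nat) (X : tensM k n -> Prop) (f : ratfun k n) : Prop :=
  exists m, X m /\ evM f.2 m != 0.

Definition rat_eq (k : fieldType) (n : nat) (X : tensM k n -> Prop) (f f' : ratfun k n) : Prop :=
  forall m, X m -> evM f.1 m * evM f'.2 m = evM f'.1 m * evM f.2 m.

Definition allM (k : fieldType) (n : nat) : tensM k n -> Prop := fun _ => True.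

Definition ginvariant (k : fieldType) (n : nat) (f : ratfun k n) : Prop :=
  rat_ok (allM (n := n)) f /\
  forall g : 'M[k]_n, g \in unitmx ->
    forall m, evM f.1 (actM g m) * evM f.2 m = evM f.1 m * evM f.2 (actM g m).

(* f |-> f|_S is well defined on k(M)^G, and is a bijection k(M)^G -> k(S)
   (it is a k-algebra homomorphism by construction, being restriction). *)
Definition restriction_iso (k : fieldType) (n : nat) (S : tensM k n -> Prop) : Prop :=
  (forall f, ginvariant f -> exists f', rat_eq (allM (n := n)) f f' /\ rat_ok S f') /\
  (forall f1 f2, ginvariant f1 -> ginvariant f2 -> rat_ok S f1 -> rat_ok S f2 ->
     rat_eq S f1 f2 -> rat_eq (allM (n := n)) f1 f2) /\
  (forall h, rat_ok S h -> exists f, ginvariant f /\ rat_ok S f /\ rat_eq S f h).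

(* Main.v *)
Require Import Defs.
From mathcomp Require Import all_boot all_order all_algebra.
From mathcomp Require Import mpoly.
From mathcomp Require Import ring.
From Stdlib Require Import Classical FunctionalExtensionality PropExtensionality.

(* An algebra structure m on k^n has two trace covectors, trL x = tr (y |-> xy)
   and trR y = tr (x |-> xy).  For generic m the form (x, y) |-> trL (xy) is
   nondegenerate, so trL (v y) = trR y determines a vector v, and v, vv, v(vv),
   ... is a basis K(m) of k^n.  This frame is equivariant, hence m is carried by
   g = K(m)^-1, and by no other g, into the set S of structures whose frame is
   the standard basis: e_0 e_i = e_(i+1) for i < n - 1 and
   trL (e_0 e_j) = trR e_j for all j.  For n >= 2 each of these equations can be
   solved for a coordinate on which it depends linearly, so S is the image of a
   polynomial retraction of the whole space; in particular it is irreducible.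
   The map m |-> K(m)^-1 . m is then an invariant rational retraction onto S, and
   composing with it inverts the restriction of invariant rational functions.
   For n = 1 the equations also allow the zero structure, so S is taken to be
   e_0 e_0 = e_0 there. *)

Set Implicit Arguments.
Unset Strict Implicit.
Unset Printing Implicit Defensive.

Import GRing.Theory.
Local Open Scope ring_scope.

(** * Nonzero polynomials have nonzero values *)

Lemma digits_inj (D n : nat) (f g : 'I_n -> nat) :
  (forall i, f i < D)%N -> (forall i, g i < D)%N ->
  (\sum_(i < n) f i * D ^ i = \sum_(i < n) g i * D ^ i)%N -> f =1 g.
Proof.
elim: n f g => [|n IHn] f g ltf ltg; first by move=> _ [].
have D_gt0 : (0 < D)%N by apply: leq_trans (ltf ord0).
have split_low (h : 'I_n.+1 -> nat) : (\sum_(i < n.+1) h i * D ^ i =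
    (\sum_(i < n) h (lift ord0 i) * D ^ i) * D + h ord0)%N.
  rewrite big_ord_recl /= expn0 muln1 addnC big_distrl /=; congr (_ + _)%N.
  by apply: eq_bigr => i _; rewrite /bump /= add1n expnSr mulnA.
rewrite !split_low => eq_fg.
have eq0 : f ord0 = g ord0.
  by have := congr1 (modn^~ D) eq_fg; rewrite !modnMDl !modn_small.
have eqS := congr1 (divn^~ D) eq_fg.
rewrite !divnMDl // !divn_small // !addn0 in eqS.
have eqL := IHn _ _ (fun i => ltf (lift ord0 i)) (fun i => ltg (lift ord0 i)) eqS.
by move=> i; case: (unliftP ord0 i) => [j|] ->.
Qed.

(* Kronecker substitution x_i := x ^ (D ^ i), with D larger than all exponents,
   keeps distinct monomials distinct. *)
Lemma mpoly_nonroot (k : closedFieldType) (n : nat) (p : {mpoly k[n]}) :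
  p != 0 -> exists v : 'I_n -> k, p.@[v] != 0.
Proof.
move=> p_neq0; set D := msize p.
pose e (m : 'X_{1..n}) := (\sum_(i < n) m i * D ^ i)%N.
pose q := \sum_(m <- msupp p) p@_m *: 'X^(e m).
have lt_supp m : m \in msupp p -> forall i, (m i < D)%N.
  move=> m_p i; apply: leq_ltn_trans (msize_mdeg_lt m_p).
  by rewrite mdegE (bigD1 i) //= leq_addr.
have q_neq0 : q != 0.
  (* As [e] is injective on the support, the coefficient of [q] at [e (mlead p)] is the leading
     coefficient of [p] alone. *)
  have m0_p := mlead_supp p_neq0.
  apply/eqP => /(congr1 (fun r : {poly k} => r`_(e (mlead p)))).
  rewrite coef0 /q coef_sum (bigD1_seq (mlead p)) //= ?msupp_uniq //.
  rewrite coefZ coefXn eqxx mulr1 big_seq_cond big1 ?addr0; last first.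
    move=> m /andP[m_p ne_m]; rewrite coefZ coefXn; case: eqP => [eq_e|]; last by rewrite mulr0.
    case/eqP: ne_m; apply/mnmP.
    by apply: (@digits_inj D) => //; apply: lt_supp.
  by apply/eqP; rewrite mleadc_eq0.
have [x nroot] := closed_nonrootP _ q_neq0.
exists (fun i => x ^+ (D ^ i)); move: nroot; rewrite /root /q horner_sum mevalE.
congr (_ != _); apply: eq_bigr => m _; rewrite hornerZ hornerXn; congr (_ * _).
rewrite /e; elim/big_rec2: _ => [|i y z _ IH]; first by rewrite expr0.
by rewrite exprD -IH -exprM mulnC.
Qed.

(** * Multiplication operators, trace covectors and the group action *)

Section Tensors.

Variables (k : fieldType) (n : nat).
Implicit Types (m : tensM k n) (g h : 'M[k]_n).

Lemma tensP m m' : (forall i j l, tens m i j l = tens m' i j l) -> m = m'.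
Proof.
case: m m' => f [f'] /= eqf; congr TensM.
by do 3 apply: functional_extensionality => ?.
Qed.

(** Matrices acting on columns: [Lb m i] is left multiplication by e_i and [Rb m j] right
    multiplication by e_j. [Lmx] and [Rmx] extend them linearly to arbitrary vectors. *)
Definition Lb m i : 'M[k]_n := \matrix_(l, j) tens m i j l.
Definition Rb m j : 'M[k]_n := \matrix_(l, i) tens m i j l.
Definition Lmx m (x : 'cV[k]_n) : 'M[k]_n := \sum_i x i 0 *: Lb m i.
Definition Rmx m (y : 'cV[k]_n) : 'M[k]_n := \sum_j y j 0 *: Rb m j.
Definition trL m : 'rV[k]_n := \row_i \tr (Lb m i).
Definition trR m : 'rV[k]_n := \row_j \tr (Rb m j).

Lemma LmxE m x l j : Lmx m x l j = \sum_i x i 0 * tens m i j l.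
Proof. by rewrite summxE; apply: eq_bigr => i _; rewrite !mxE. Qed.

Lemma RmxE m y l i : Rmx m y l i = \sum_j y j 0 * tens m i j l.
Proof. by rewrite summxE; apply: eq_bigr => j _; rewrite !mxE. Qed.

Lemma Lmx_delta m i : Lmx m (delta_mx i 0) = Lb m i.
Proof.
rewrite /Lmx (bigD1 i) //= big1 ?addr0 => [|j ne_j]; rewrite mxE.
  by rewrite !eqxx scale1r.
by rewrite (negbTE ne_j) scale0r.
Qed.

(** Both sides are the product of x and y in the algebra m; this carries the transformation law of
    [Lmx] over to [Rmx]. *)
Lemma Lmx_Rmx m x y : Lmx m x *m y = Rmx m y *m x.
Proof.
apply/matrixP => l z; rewrite ord1 !mxE.
under eq_bigr => j _ do rewrite LmxE big_distrl /=.
rewrite exchange_big /=; apply: eq_bigr => i _.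
rewrite RmxE big_distrl /=; apply: eq_bigr => j _.
by ring.
Qed.

Lemma trL_mul m x : trL m *m x = (\tr (Lmx m x))%:M.
Proof.
apply/matrixP => i j; rewrite !ord1 !mxE mulr1n /Lmx linear_sum.
by apply: eq_bigr => l _; rewrite linearZ /= !mxE mulrC.
Qed.

Lemma trR_mul m x : trR m *m x = (\tr (Rmx m x))%:M.
Proof.
apply/matrixP => i j; rewrite !ord1 !mxE mulr1n /Rmx linear_sum.
by apply: eq_bigr => l _; rewrite linearZ /= !mxE mulrC.
Qed.

Lemma tens_Lmx m i j l : tens m i j l = Lmx m (delta_mx i 0) l j.
Proof. by rewrite Lmx_delta mxE. Qed.

Lemma eq_mulmx_cV p q (A B : 'M[k]_(p, q)) :
  (forall x : 'cV_q, A *m x = B *m x) -> A = B.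
Proof.
move=> eqAB; apply/matrixP => i j.
have /(congr1 (fun C : 'cV_p => C i 0)) := eqAB (delta_mx j 0).
by rewrite -!colE !mxE.
Qed.

Lemma Lmx_act m g x : Lmx (actM g m) x = g *m Lmx m (invmx g *m x) *m invmx g.
Proof.
apply/matrixP => l j; rewrite LmxE.
(* The summand of the expanded left side. The exchanges below bring the summation into the order b,
   c, a, i in which the matrix product unfolds. *)
pose t i a b c := x i 0 * (g l c * tens m a b c * invmx g a i * invmx g b j).
transitivity (\sum_i \sum_a \sum_b \sum_c t i a b c).
  apply: eq_bigr => i _; rewrite big_distrr; apply: eq_bigr => a _ /=.
  by rewrite big_distrr; apply: eq_bigr => b _ /=; rewrite big_distrr.
rewrite exchange_big /=; under eq_bigr => a _ do rewrite exchange_big /=.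
rewrite exchange_big mxE; apply: eq_bigr => b _ /=.
under eq_bigr => a _ do rewrite exchange_big /=.
rewrite exchange_big mxE big_distrl; apply: eq_bigr => c _ /=.
rewrite LmxE big_distrr big_distrl; apply: eq_bigr => a _ /=.
rewrite mxE big_distrl big_distrr big_distrl; apply: eq_bigr => i _ /=.
rewrite /t; ring.
Qed.

Lemma Rmx_act m g y : Rmx (actM g m) y = g *m Rmx m (invmx g *m y) *m invmx g.
Proof.
apply: eq_mulmx_cV => x.
by rewrite -Lmx_Rmx Lmx_act -!mulmxA Lmx_Rmx.
Qed.

Lemma trL_act m g : g \in unitmx -> trL (actM g m) = trL m *m invmx g.
Proof.
move=> g_unit; apply: eq_mulmx_cV => x; rewrite -mulmxA !trL_mul Lmx_act.
by rewrite mxtrace_mulC mulmxA mulVmx // mul1mx.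
Qed.

Lemma trR_act m g : g \in unitmx -> trR (actM g m) = trR m *m invmx g.
Proof.
move=> g_unit; apply: eq_mulmx_cV => x; rewrite -mulmxA !trR_mul Rmx_act.
by rewrite mxtrace_mulC mulmxA mulVmx // mul1mx.
Qed.

Lemma actM1 m : actM 1%:M m = m.
Proof.
by apply: tensP => i j l; rewrite !tens_Lmx Lmx_act invmx1 !mul1mx mulmx1.
Qed.

Lemma actMM m g h : g \in unitmx -> h \in unitmx ->
  actM g (actM h m) = actM (g *m h) m.
Proof.
move=> g_unit h_unit; apply: tensP => i j l; rewrite !tens_Lmx !Lmx_act.
suff -> : invmx (g *m h) = invmx h *m invmx g by rewrite !mulmxA.
have gh_unit : g *m h \in unitmx by rewrite unitmx_mul g_unit.
have inv_gh : invmx h *m invmx g *m (g *m h) = 1%:M.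
  by rewrite !mulmxA -(mulmxA (invmx h)) mulVmx // mulmx1 mulVmx.
by rewrite -[LHS]mul1mx -inv_gh mulmxK.
Qed.

End Tensors.

(** * Functions regular on a principal open set *)

Section Regular.

Variables (k : fieldType) (n : nat).
Implicit Types (d p q : polyM k n) (F G : tensM k n -> k).

Lemma evMD p q m : evM (p + q) m = evM p m + evM q m.
Proof. exact: mevalD. Qed.

Lemma evMM p q m : evM (p * q) m = evM p m * evM q m.
Proof. exact: mevalM. Qed.

Lemma evMXn p N m : evM (p ^+ N) m = evM p m ^+ N.
Proof. exact: rmorphXn. Qed.

Lemma evMC c m : evM (c%:MP : polyM k n) m = c.
Proof. exact: mevalC. Qed.

Lemma evM1 m : evM (1 : polyM k n) m = 1.
Proof. exact: meval1. Qed.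

Lemma evM_tens i j l m :
  evM ('X_(enum_rank ((i, j, l) : idxM n)) : polyM k n) m = tens m i j l.
Proof. by rewrite /evM mevalXU /coordM enum_rankK. Qed.

(* [F] agrees with a fraction [p / d ^+ N] on the locus [d != 0]; taking
   [d = 1] gives the polynomial functions. *)
Definition regular d F := exists p N, forall m,
  evM d m != 0 -> F m * evM d m ^+ N = evM p m.

Lemma regular1P F : regular 1 F -> exists p, forall m, evM p m = F m.
Proof.
move=> [p [N pE]]; exists p => m.
by rewrite -pE evM1 ?expr1n ?mulr1 ?oner_neq0.
Qed.

Lemma eq_regular d F G : (forall m, evM d m != 0 -> F m = G m) ->
  regular d F -> regular d G.
Proof. by move=> eqFG [p [N pE]]; exists p, N => m dm; rewrite -eqFG ?pE. Qed.

Lemma regular_evM d p : regular d (evM p).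
Proof. by exists p, 0%N => m _; rewrite mulr1. Qed.

Lemma regular_const d c : regular d (fun=> c).
Proof. by apply: eq_regular (regular_evM d c%:MP) => m _; rewrite evMC. Qed.

Lemma regular_tens d i j l : regular d (fun m => tens m i j l).
Proof.
by apply: eq_regular (regular_evM d 'X_(enum_rank ((i, j, l) : idxM n))) => m _; rewrite evM_tens.
Qed.

Lemma regularD d F G : regular d F -> regular d G -> regular d (fun m => F m + G m).
Proof.
move=> [p [N pE]] [q [N' qE]]; exists (p * d ^+ N' + q * d ^+ N), (N + N')%N => m dm.
by rewrite evMD !evMM !evMXn -pE // -qE // exprD; ring.
Qed.

Lemma regularM d F G : regular d F -> regular d G -> regular d (fun m => F m * G m).
Proof.
move=> [p [N pE]] [q [N' qE]]; exists (p * q), (N + N')%N => m dm.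
by rewrite evMM -pE // -qE // exprD; ring.
Qed.

Lemma regularB d F G : regular d F -> regular d G -> regular d (fun m => F m - G m).
Proof.
move=> rF rG; have := regularD rF (regularM (regular_const d (-1)) rG).
by apply: eq_regular => m _; rewrite mulN1r.
Qed.

Lemma regularX d F N : regular d F -> regular d (fun m => F m ^+ N).
Proof.
move=> rF; elim: N => [|N IHN]; first exact: regular_const.
by apply: eq_regular (regularM rF IHN) => m _; rewrite exprS.
Qed.

Lemma regular_sum (I : Type) (r : seq I) (P : pred I) d (F : I -> tensM k n -> k) :
  (forall i, regular d (F i)) -> regular d (fun m => \sum_(i <- r | P i) F i m).
Proof.
move=> rF; elim: r => [|i r IHr].
  by apply: eq_regular (regular_const d 0) => m _; rewrite big_nil.
case Pi: (P i).
  by apply: eq_regular (regularD (rF i) IHr) => m _; rewrite big_cons Pi.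
by apply: eq_regular IHr => m _; rewrite big_cons Pi.
Qed.

Lemma regular_prod (I : Type) (r : seq I) d (F : I -> tensM k n -> k) :
  (forall i, regular d (F i)) -> regular d (fun m => \prod_(i <- r) F i m).
Proof.
move=> rF; elim: r => [|i r IHr].
  by apply: eq_regular (regular_const d 1) => m _; rewrite big_nil.
by apply: eq_regular (regularM (rF i) IHr) => m _; rewrite big_cons.
Qed.

Lemma regular_comp d p (psi : tensM k n -> tensM k n) :
  (forall i j l, regular d (fun m => tens (psi m) i j l)) ->
  regular d (fun m => evM p (psi m)).
Proof.
move=> rpsi; pose F m := \sum_(u <- msupp p) p@_u * \prod_i coordM (psi m) i ^+ u i.
apply: (@eq_regular _ F) => [m _|]; first by rewrite /evM mevalE.
apply: regular_sum => u; apply: regularM; first exact: regular_const.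
by apply: regular_prod => i; apply: regularX; apply: rpsi.
Qed.

Lemma regularV d F G : (forall m, evM d m != 0 -> F m * G m = 1) ->
  regular d G -> regular d (fun m => (F m)^-1).
Proof.
move=> FG1; apply: eq_regular => m /FG1 FG.
have F_neq0 : F m != 0 by apply: contra_eq_neq FG => ->; rewrite mul0r eq_sym oner_neq0.
by rewrite -[LHS](mulKf F_neq0) FG mulr1.
Qed.

Lemma regular_mul_poly d q F : regular d F -> regular (d * q) F.
Proof.
move=> [p [N pE]]; exists (p * q ^+ N), N => m.
by rewrite evMM mulf_eq0 => /norP[dm _]; rewrite exprMn mulrA pE // evMM evMXn.
Qed.

Definition regular_mx d a b (A : tensM k n -> 'M[k]_(a, b)) :=
  forall i j, regular d (fun m => A m i j).

Lemma eq_regular_mx d a b (A B : tensM k n -> 'M[k]_(a, b)) :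
  (forall m, evM d m != 0 -> A m = B m) -> regular_mx d A -> regular_mx d B.
Proof.
by move=> eqAB rA i j; apply: eq_regular (rA i j) => m dm; rewrite eqAB.
Qed.

Lemma regular_mulmx d a b c (A : tensM k n -> 'M[k]_(a, b)) (B : tensM k n -> 'M[k]_(b, c)) :
  regular_mx d A -> regular_mx d B -> regular_mx d (fun m => A m *m B m).
Proof.
move=> rA rB i j.
apply: (@eq_regular _ (fun m => \sum_l A m i l * B m l j)) => [m _|]; first by rewrite mxE.
by apply: regular_sum => l; apply: regularM.
Qed.

Lemma regular_det d a (A : tensM k n -> 'M[k]_a) :
  regular_mx d A -> regular d (fun m => \det (A m)).
Proof.
move=> rA; apply: regular_sum => s; apply: regularM; first exact: regular_const.
exact: regular_prod.
Qed.

(** Cramer's rule: an entry of the inverse is a cofactor divided by the determinant, and [F] is a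
    regular inverse of that determinant where [d] is nonzero. *)
Lemma regular_invmx d a (A : tensM k n -> 'M[k]_a) (F : tensM k n -> k) :
  regular_mx d A -> regular d F -> (forall m, evM d m != 0 -> \det (A m) * F m = 1) ->
  regular_mx d (fun m => invmx (A m)).
Proof.
move=> rA rF dF i j.
pose C m := (\det (A m))^-1 * ((-1) ^+ (j + i) * \det (row' j (col' i (A m)))).
apply: (@eq_regular _ C) => [m /dF dFm|].
  rewrite /invmx unitmxE unitfE ifT ?mxE //.
  by apply: contra_eq_neq dFm => ->; rewrite mul0r eq_sym oner_neq0.
apply: regularM; first exact: regularV rF.
apply: regularM; first exact: regular_const.
apply: regular_det => i' j'.
by apply: eq_regular (rA (lift j i') (lift i j')) => m _; rewrite !mxE.
Qed.

Lemma regular_act d (g : tensM k n -> 'M[k]_n) (m0 : tensM k n -> tensM k n) i j l :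
  regular_mx d g -> regular_mx d (fun m => invmx (g m)) ->
  (forall i j l, regular d (fun m => tens (m0 m) i j l)) ->
  regular d (fun m => tens (actM (g m) (m0 m)) i j l).
Proof.
move=> rg rg' rm; do 3 (apply: regular_sum => ?).
by do 3 (apply: regularM => //).
Qed.

End Regular.

Lemma evM_nonroot (k : closedFieldType) n (p : polyM k n) :
  p != 0 -> exists m, evM p m != 0.
Proof.
move=> /mpoly_nonroot[v pv].
exists (TensM (fun i j l => v (enum_rank ((i, j, l) : idxM n)))).
rewrite /evM (meval_eq (v2 := v)) // => i.
rewrite /coordM /=; case def_x: (enum_val i) => [[a b] c] /=.
by rewrite -def_x enum_valK.
Qed.

(** The conclusion of the theorem for one [n], named so that n = 0, n = 1 and n >= 2 can be treated
    separately. *)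
Definition normal_form (k : closedFieldType) (n : nat) : Prop :=
  exists (s t : seq (polyM k n)),
    (forall p, p \in s -> nonconstant p) /\
    (forall q, q \in t -> nonconstant q) /\
    let S := fun m : tensM k n => forall p, p \in s -> evM p m = 0 in
    let U := fun m : tensM k n => forall q, q \in t -> evM q m != 0 in
    (zirreducible S /\ restriction_iso S) /\
    zdense U /\
    (forall a, U a ->
       exists g : 'M[k]_n, g \in unitmx /\ S (actM g a) /\
         forall g' : 'M[k]_n, g' \in unitmx -> S (actM g' a) -> g' = g).

(** * From a slice with unique moving elements to the normal form *)

Section Slice.

Variables (k : closedFieldType) (n : nat) (I : finType).
(** The slice [S] is cut out by the [F i], and [phi] is a polynomial retraction of the whole space
    onto it. On the invariant open set where [d] is nonzero, [gam m] is the only group element that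
    moves [m] into [S]; [psi] is the resulting invariant rational retraction. *)
Variables (F : I -> tensM k n -> k) (d : polyM k n) (gam : tensM k n -> 'M[k]_n).
Variables (phi : tensM k n -> tensM k n) (s0 : tensM k n).
Let S m := forall i, F i m = 0.

Hypothesis F_poly : forall i, regular 1 (F i).
Hypothesis phi_poly : forall i j l, regular 1 (fun m => tens (phi m) i j l).
Hypothesis phiS : forall m, S (phi m).
Hypothesis phi_id : forall m, S m -> phi m = m.
Hypothesis s0S : S s0.
Hypothesis s0d : evM d s0 != 0.
Hypothesis d_act : forall g m, g \in unitmx -> evM d m != 0 -> evM d (actM g m) != 0.
Hypothesis gam_regular : regular_mx d gam.
Hypothesis gamV_regular : regular_mx d (fun m => invmx (gam m)).
Hypothesis gam_unit : forall m, evM d m != 0 -> gam m \in unitmx.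
Hypothesis gamS : forall m, evM d m != 0 -> S (actM (gam m) m).
Hypothesis gam_uniq : forall m g, evM d m != 0 -> g \in unitmx ->
  S (actM g m) -> g = gam m.

Let psi m := actM (gam m) m.

Lemma d_neq0 : d != 0.
Proof. by apply: contraNneq s0d => ->; rewrite /evM meval0. Qed.

(** Since [phi] fixes [S] pointwise, the pullbacks of [p] and [q] along [phi] are nonzero
    polynomials on the whole space. So is their product, and [phi] sends a point where it does not
    vanish to the required point of [S]. *)
Lemma slice_nonroot p q m m' : S m -> S m' -> evM p m != 0 -> evM q m' != 0 ->
  exists s, [/\ S s, evM p s != 0 & evM q s != 0].
Proof.
move=> Sm Sm' pm qm'.
have [p' p'E] := regular1P (regular_comp p phi_poly).
have [q' q'E] := regular1P (regular_comp q phi_poly).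
have p'_neq0 : p' != 0.
  apply: contraNneq pm => p'0.
  by rewrite -[m in evM p m]phi_id // -p'E p'0 /evM meval0.
have q'_neq0 : q' != 0.
  apply: contraNneq qm' => q'0.
  by rewrite -[m' in evM q m']phi_id // -q'E q'0 /evM meval0.
have [x] := evM_nonroot (mulf_neq0 p'_neq0 q'_neq0).
rewrite evMM mulf_eq0 p'E q'E => /norP[px qx].
by exists (phi x).
Qed.

Lemma nonroot_domain p : p != 0 -> exists m, evM d m != 0 /\ evM p m != 0.
Proof.
move=> p_neq0; have [m] := evM_nonroot (mulf_neq0 d_neq0 p_neq0).
by rewrite evMM mulf_eq0 => /norP[dm pm]; exists m.
Qed.

Lemma evM_eq0_domain p : (forall m, evM d m != 0 -> evM p m = 0) -> p = 0.
Proof.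
move=> p0; apply/eqP; apply: contraT => /nonroot_domain[m [dm]].
by rewrite p0 ?eqxx.
Qed.

Lemma slice_irreducible : zirreducible S.
Proof.
split; first by exists s0.
move=> Z1 Z2 [F1 Z1E] [F2 Z2E] subS.
case: (classic (forall m, S m -> Z1 m)) => [|nZ1]; [by left | right].
have [m Sm [p1 F1p1 p1m]] : exists2 m, S m & exists2 p, F1 p & evM p m != 0.
  apply: NNPP => no_m; apply: nZ1 => m Sm; apply/Z1E => p F1p.
  apply/eqP; apply: contraT => pm; case: no_m; exists m => //.
  by exists p.
move=> m' Sm'; apply/Z2E => p2 F2p2; apply/eqP; apply: contraT => p2m'.
have [s [/subS[/Z1E Z1s | /Z2E Z2s] p1s p2s]] := slice_nonroot Sm Sm' p1m p2m'.
  by rewrite Z1s ?eqxx in p1s.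
by rewrite Z2s ?eqxx in p2s.
Qed.

Lemma psi_regular p : regular d (fun m => evM p (psi m)).
Proof.
apply: regular_comp => i j l; apply: regular_act => // *; exact: regular_tens.
Qed.

Lemma psi_id m : S m -> evM d m != 0 -> psi m = m.
Proof.
move=> Sm dm; rewrite /psi -(@gam_uniq m 1%:M) ?unitmx1 ?actM1 //.
Qed.

(** By uniqueness: [gam (actM g m) *m g] also moves [m] into [S], so it equals [gam m]. *)
Lemma psi_act g m : g \in unitmx -> evM d m != 0 -> psi (actM g m) = psi m.
Proof.
move=> g_unit dm; have dgm := d_act g_unit dm.
have gg_unit := gam_unit dgm.
rewrite /psi actMM // (@gam_uniq m (gam (actM g m) *m g)) //.
  by rewrite unitmx_mul gg_unit.
by rewrite -actMM //; apply: gamS.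
Qed.

Lemma act_psi m : evM d m != 0 -> actM (invmx (gam m)) (psi m) = m.
Proof.
move=> dm; have g_unit := gam_unit dm.
by rewrite /psi actMM ?unitmx_inv // mulVmx // actM1.
Qed.

(** The given denominator [q] may vanish on all of [S]. Choose [a] in the domain with [q] nonzero at
    [a] and translate the fraction by [h], the inverse of [gam a]. Invariance leaves the rational
    function unchanged, and the new denominator takes at [psi a], a point of [S], the value of [q]
    at [a]. *)
Lemma restriction_defined f : ginvariant f ->
  exists f', Defs.rat_eq (allM (n := n)) f f' /\ rat_ok S f'.
Proof.
case: f => p q [[m0 [_ /= qm0]] inv_f].
have q_neq0 : q != 0 by apply: contraNneq qm0 => ->; rewrite /evM meval0.
have [a [da qa]] := nonroot_domain q_neq0; pose h := invmx (gam a).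
have h_unit : h \in unitmx by rewrite unitmx_inv gam_unit.
have comp_h r : exists r', forall m, evM r' m = evM r (actM h m).
  apply: regular1P; apply: regular_comp => i j l.
  by apply: (@regular_act _ _ _ (fun=> h) id) => [? ?|? ?|? ? ?];
    first [exact: regular_const | exact: regular_tens].
have [[p' p'E] [q' q'E]] := (comp_h p, comp_h q).
exists (p', q'); split=> [m _ /=|]; first by rewrite p'E q'E inv_f.
by exists (psi a); rewrite /= q'E act_psi //; split=> //; apply: gamS.
Qed.

(** By invariance each fraction agrees at [m] and at [psi m], up to cross-multiplication, and at
    [psi m] the two fractions agree by assumption. *)
Lemma restriction_injective f1 f2 : ginvariant f1 -> ginvariant f2 ->
  rat_ok S f1 -> rat_ok S f2 -> Defs.rat_eq S f1 f2 -> Defs.rat_eq (allM (n := n)) f1 f2.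
Proof.
case: f1 f2 => [p1 q1] [p2 q2] [_ /= inv1] [_ /= inv2] [s1 [Ss1 /= q1s]] [s2 [Ss2 /= q2s]] /= eqS.
have [r1 [N1 r1E]] := psi_regular q1; have [r2 [N2 r2E]] := psi_regular q2.
(* At a point of [S] where [q] and [d] are both nonzero, [psi] is the identity, so the numerator [r]
   of [q] composed with [psi] is nonzero there. *)
have r_neq0 q r N s : (forall m, evM d m != 0 -> evM q (psi m) * evM d m ^+ N = evM r m) ->
    S s -> evM q s != 0 -> r != 0.
  move=> rE Ss qs; have [x [Sx qx dx]] := slice_nonroot Ss s0S qs s0d.
  apply: contraNneq (mulf_neq0 qx (expf_neq0 N dx)) => r0.
  by rewrite -{1}(psi_id Sx dx) rE // r0 /evM meval0.
(* The denominators may vanish at individual points [psi m]. Multiplying by their numerators [r1]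
   and [r2] turns the claim into a polynomial identity, from which these nonzero factors cancel. *)
suff : (p1 * q2 - p2 * q1) * (r1 * r2) = 0.
  move/eqP; rewrite mulf_eq0 mulf_eq0.
  rewrite (negbTE (r_neq0 _ _ _ _ r1E Ss1 q1s)) (negbTE (r_neq0 _ _ _ _ r2E Ss2 q2s)) !orbF.
  by rewrite subr_eq0 => /eqP eqp m _ /=; rewrite -!evMM eqp.
apply: evM_eq0_domain => m dm; rewrite !evMM -r1E // -r2E //.
have g_unit := gam_unit dm.
have := eqS _ (gamS dm); have := inv1 _ g_unit m; have := inv2 _ g_unit m.
rewrite -/(psi m) /evM mevalB !mevalM -!/(evM _ _) => e2 e1 e12.
set x1 := evM p1 (psi m) in e1 e12 *; set x2 := evM p2 (psi m) in e2 e12 *.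
set y1 := evM q1 (psi m) in e1 e12 *; set y2 := evM q2 (psi m) in e2 e12 *.
set D1 := _ ^+ N1; set D2 := _ ^+ N2.
transitivity (((evM p1 m * y1) * (evM q2 m * y2) - (evM p2 m * y2) * (evM q1 m * y1)) * (D1 * D2)).
  by ring.
rewrite -e1 -e2.
transitivity ((x1 * y2 - x2 * y1) * (evM q1 m * evM q2 m * (D1 * D2))); first by ring.
by rewrite e12 subrr mul0r.
Qed.

Lemma restriction_surjective h : rat_ok S h ->
  exists f, ginvariant f /\ rat_ok S f /\ Defs.rat_eq S f h.
Proof.
case: h => p q [s [Ss /= qs]].
have [P [N PE]] := psi_regular p; have [Q [N' QE]] := psi_regular q.
have fE r R M M' m : (forall m, evM d m != 0 -> evM r (psi m) * evM d m ^+ M = evM R m) ->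
    evM (R * d ^+ M'.+1) m = if evM d m == 0 then 0 else evM r (psi m) * evM d m ^+ (M + M').+1.
  move=> RE; rewrite evMM evMXn; case: eqP => [-> | /eqP dm]; first by rewrite expr0n mulr0.
  by rewrite -RE // -mulrA -exprD addnS.
have [x [Sx qx dx]] := slice_nonroot Ss s0S qs s0d.
(* This is [p / q] composed with [psi], with the powers of [d] cleared crosswise. One more factor
   [d] on each side makes both parts vanish where [d] does, so that the identities hold at every
   point and not only on the domain of [psi]. *)
pose f : ratfun k n := (P * d ^+ N'.+1, Q * d ^+ N.+1).
have f2x : evM f.2 x != 0.
  by rewrite (fE _ _ _ _ _ QE) (negbTE dx) psi_id // mulf_neq0 ?expf_neq0.
exists f; split; [split; first by exists x | split; first by exists x].
  move=> g g_unit m /=; rewrite !(fE _ _ _ _ _ QE) !(fE _ _ _ _ _ PE).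
  have [d0|dgm] := eqVneq (evM d (actM g m)) 0.
    have [_|dm] := eqVneq (evM d m) 0; first by rewrite ?mul0r ?mulr0.
    by have := d_act g_unit dm; rewrite d0 eqxx.
  have [_|dm] := eqVneq (evM d m) 0; first by rewrite ?mul0r ?mulr0.
  by rewrite psi_act // (addnC N'); ring.
move=> m Sm /=; rewrite (fE _ _ _ _ _ QE) (fE _ _ _ _ _ PE).
have [_|dm] := eqVneq (evM d m) 0; first by rewrite ?mul0r ?mulr0.
by rewrite psi_id // (addnC N'); ring.
Qed.

Lemma domain_dense : zdense (fun m => evM d m != 0).
Proof.
move=> Z [FZ ZE] subZ m; apply/ZE => p Fp.
rewrite (_ : p = 0) ?/evM ?meval0 //.
by apply: evM_eq0_domain => x /subZ/ZE; apply.
Qed.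

Lemma slice_normal_form : normal_form k n.
Proof.
have [P PE] := fin_all_exists (fun i => regular1P (F_poly i)).
(* Dropping zero polynomials does not change the zero set. The remaining ones vanish at [s0], hence
   are nonconstant. *)
pose s := [seq p <- codom P | p != 0].
have [t t_nonconst tU] : exists2 t : seq (polyM k n), forall q, q \in t -> nonconstant q &
    forall m, (forall q, q \in t -> evM q m != 0) <-> evM d m != 0.
  (* If [d] is constant, its value at [s0] shows that it vanishes nowhere, and the empty list
     describes the domain. *)
  case: (classic (nonconstant d)) => [nc_d | c_d].
    exists [:: d] => [q|m]; first by rewrite inE => /eqP->.
    by split=> [|dm q]; [apply; rewrite inE | rewrite inE => /eqP->].
  exists [::] => // m; split=> // _.
  have [c dc] : exists c, d = c%:MP.
    by apply: NNPP => no_c; apply: c_d => c dc; apply: no_c; exists c.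
  by move: s0d; rewrite dc !evMC.
have sS : (fun m => forall p, p \in s -> evM p m = 0) = S.
  apply: functional_extensionality => m; apply: propositional_extensionality.
  split=> [s0m i | Sm p]; last first.
    by rewrite mem_filter => /andP[_ /codomP[i ->]]; rewrite PE.
  rewrite -PE; have [->|Pi] := eqVneq (P i) 0; first by rewrite /evM meval0.
  by apply: s0m; rewrite mem_filter Pi codom_f.
have tUE : (fun m => forall q, q \in t -> evM q m != 0) = (fun m => evM d m != 0).
  by apply: functional_extensionality => m; apply: propositional_extensionality.
exists s, t; split=> [p | ].
  rewrite mem_filter => /andP[/negP p_neq0 /codomP[i def_p]] c pc; case: p_neq0.
  by move: (s0S i); rewrite -PE -def_p pc evMC => ->; rewrite mpolyC0.
split=> // S' U'; have -> : S' = S by []; have -> : U' = _ := tUE; split.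
  split; first exact: slice_irreducible.
  split; first exact: restriction_defined.
  by split; [apply: restriction_injective | apply: restriction_surjective].
split; first exact: domain_dense.
move=> a da; exists (gam a); split; first exact: gam_unit.
split; first exact: gamS.
by move=> g g_unit; apply: gam_uniq.
Qed.

End Slice.

Lemma regular_inv_den (k : fieldType) n (d : polyM k n) :
  regular d (fun m => (evM d m)^-1).
Proof. by exists 1, 1%N => m dm; rewrite expr1 mulVf // evM1. Qed.

(** * The equivariant frame of a structure *)

Section Frame.

Variables (k : fieldType) (N : nat).
Local Notation n := N.+2.
Implicit Types (m : tensM k n) (g X : 'M[k]_n).

(** With v the first column of [X], the first equation is trL (v y) = trR y for all y. The second
    says that v times column i is column i + 1: [lift ord_max i] has value i and [lift ord0 i] has
    value i + 1. *)
Definition is_frame m X :=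
  trL m *m Lmx m (col ord0 X) = trR m /\
  forall i : 'I_N.+1,
    Lmx m (col ord0 X) *m col (lift ord_max i) X = col (lift ord0 i) X.

Lemma is_frame_act m g X : g \in unitmx ->
  is_frame (actM g m) X <-> is_frame m (invmx g *m X).
Proof.
move=> g_unit; rewrite /is_frame.
have colM i : col i (invmx g *m X) = invmx g *m col i X by rewrite !colE mulmxA.
rewrite trL_act // trR_act // Lmx_act -colM.
split=> -[frB frL]; split=> [|i].
- have := congr1 (mulmx^~ g) frB; rewrite !mulmxA !mulmxKV //.
- by rewrite !(colM (lift _ _)) -[in RHS]frL -!mulmxA mulKmx.
- by rewrite !mulmxA mulmxKV // frB.
- by rewrite -[RHS](mulKVmx g_unit) -colM -frL (colM (lift _ _)) !mulmxA.
Qed.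

Definition trace_form m : 'M[k]_n := \matrix_(i, j) (trL m *m Lb m i) 0 j.

Lemma mul_trace_form m (x : 'cV[k]_n) : x^T *m trace_form m = trL m *m Lmx m x.
Proof.
apply/matrixP => z j; rewrite ord1 /Lmx mulmx_sumr summxE mxE.
by apply: eq_bigr => i _; rewrite -scalemxAr !mxE.
Qed.

Lemma trace_form_act m g : g \in unitmx ->
  trace_form (actM g m) = (invmx g)^T *m trace_form m *m invmx g.
Proof.
move=> g_unit; apply/row_matrixP => i; rewrite !rowE -trmx_delta mul_trace_form.
rewrite !mulmxA -trmx_mul mul_trace_form trL_act // Lmx_act.
by rewrite !mulmxA mulmxKV.
Qed.

(** The solution v of v^T B = trR, where B is the Gram matrix [trace_form m] of (x, y) |-> trL
    (xy). *)
Definition frame_vec m : 'cV[k]_n := (trR m *m invmx (trace_form m))^T.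

Definition frame_mx m : 'M[k]_n := \matrix_(l, i) (Lmx m (frame_vec m) ^+ i *m frame_vec m) l 0.

Lemma col_frame_mx m i : col i (frame_mx m) = Lmx m (frame_vec m) ^+ i *m frame_vec m.
Proof. by apply/matrixP => l z; rewrite ord1 !mxE. Qed.

Lemma frame_mx_frame m : trace_form m \in unitmx -> is_frame m (frame_mx m).
Proof.
move=> B_unit; have col0K : col ord0 (frame_mx m) = frame_vec m.
  by rewrite col_frame_mx expr0 mul1mx.
split=> [|i]; rewrite col0K; first by rewrite -mul_trace_form trmxK mulmxKV.
by rewrite !col_frame_mx lift_max lift0 exprS mulmxA.
Qed.

(** Nondegeneracy determines the first column from the trace equation; the recursion then determines
    the others one by one. *)
Lemma frame_mx_uniq m X : trace_form m \in unitmx -> is_frame m X -> X = frame_mx m.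
Proof.
move=> B_unit [frB frL].
have col0X : col ord0 X = frame_vec m.
  by rewrite /frame_vec -frB -mul_trace_form mulmxK // trmxK.
rewrite col0X in frL.
have colX i : forall j : 'I_n, j = i :> nat -> col j X = Lmx m (frame_vec m) ^+ i *m frame_vec m.
  elim: i => [|i IHi] j.
    by move=> j0; rewrite (_ : j = ord0) ?col0X ?expr0 ?mul1mx //; apply: val_inj.
  case: (unliftP ord0 j) => [j'|] -> //; rewrite lift0 => -[def_i].
  by rewrite -frL IHi ?lift_max // exprS mulmxA.
apply/matrixP => l j; have := congr1 (fun C : 'cV_n => C l 0) (colX j j erefl).
by rewrite -col_frame_mx !mxE.
Qed.

(** The group carries frames to frames, and the frame of the transformed structure is unique. *)
Lemma frame_mx_act m g : g \in unitmx -> trace_form m \in unitmx ->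
  frame_mx (actM g m) = g *m frame_mx m.
Proof.
move=> g_unit B_unit; apply/esym/frame_mx_uniq.
  by rewrite trace_form_act // !unitmx_mul unitmx_tr unitmx_inv g_unit B_unit.
by apply/is_frame_act => //; rewrite mulKmx //; apply: frame_mx_frame.
Qed.

Lemma regular_trL d (psi : tensM k n -> tensM k n) :
  (forall i j l, regular d (fun m => tens (psi m) i j l)) ->
  regular_mx d (fun m => trL (psi m)).
Proof.
move=> rpsi z i; apply: (@eq_regular _ _ _ (fun m => \sum_j tens (psi m) i j j)).
  by move=> m _; rewrite mxE; apply: eq_bigr => j _; rewrite mxE.
exact: regular_sum.
Qed.

Lemma regular_trR d (psi : tensM k n -> tensM k n) :
  (forall i j l, regular d (fun m => tens (psi m) i j l)) ->
  regular_mx d (fun m => trR (psi m)).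
Proof.
move=> rpsi z j; apply: (@eq_regular _ _ _ (fun m => \sum_i tens (psi m) i j i)).
  by move=> m _; rewrite mxE; apply: eq_bigr => i _; rewrite mxE.
by apply: regular_sum.
Qed.

Lemma regular_Lb d i : regular_mx d (fun m => Lb m i).
Proof.
by move=> l j; apply: eq_regular (regular_tens d i j l) => m _; rewrite mxE.
Qed.

Lemma regular_trace_form d : regular_mx d trace_form.
Proof.
move=> i j.
have := regular_mulmx (regular_trL (regular_tens d)) (regular_Lb d i).
by move/(_ 0 j); apply: eq_regular => m _; rewrite [RHS]mxE.
Qed.

Lemma regular_frame_mx d : (forall m, evM d m = \det (trace_form m)) -> regular_mx d frame_mx.
Proof.
move=> dE.
have rB : regular_mx d (fun m => invmx (trace_form m)).
  apply: regular_invmx (regular_trace_form d) (regular_inv_den d) _ => m dm.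
  by rewrite -dE mulfV.
have rv : regular_mx d frame_vec.
  move=> i z; have := regular_mulmx (regular_trR (regular_tens d)) rB.
  by move/(_ 0 i); apply: eq_regular => m _; rewrite ord1 [RHS]mxE.
have rL : regular_mx d (fun m => Lmx m (frame_vec m)).
  move=> l j; apply: (@eq_regular _ _ _ (fun m => \sum_i frame_vec m i 0 * tens m i j l)).
    by move=> m _; rewrite LmxE.
  by apply: regular_sum => i; apply: regularM; [apply: rv | apply: regular_tens].
have rK i : regular_mx d (fun m => Lmx m (frame_vec m) ^+ i *m frame_vec m).
  elim: i => [|i IHi].
    by apply: eq_regular_mx rv => m _; rewrite expr0 mul1mx.
  by apply: eq_regular_mx (regular_mulmx rL IHi) => m _; rewrite exprS mulmxA.
by move=> l i; apply: eq_regular (rK i l 0) => m _; rewrite [RHS]mxE.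
Qed.

Lemma frame_domain : exists d : polyM k n,
  [/\ forall m, (evM d m != 0) = (trace_form m \in unitmx) && (frame_mx m \in unitmx),
      regular_mx d frame_mx & regular_mx d (fun m => invmx (frame_mx m))].
Proof.
have [d1 d1E] := regular1P (regular_det (regular_trace_form 1)).
have rK := regular_frame_mx d1E.
have [P [M PE]] := regular_det rK.
have rKd : regular_mx (d1 * P) frame_mx by move=> i j; apply: regular_mul_poly.
exists (d1 * P); split=> // [m|].
  rewrite evMM mulf_eq0 negb_or !unitmxE !unitfE -d1E.
  have [//|dm /=] := eqVneq (evM d1 m) 0.
  by rewrite -PE // mulf_eq0 negb_or expf_neq0 ?andbT.
(* Since det K times [d1 ^+ M] equals [P], where K is the frame matrix, the inverse of det K is
   [d1 ^+ M.+1] divided by [d1 * P]. *)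
apply: (regular_invmx (F := fun m => evM (d1 ^+ M.+1) m * (evM (d1 * P) m)^-1)) rKd _ _.
  by apply: regularM; [apply: regular_evM | apply: regular_inv_den].
move=> m; rewrite evMM => dPm; have := dPm; rewrite mulf_eq0 negb_or => /andP[dm Pm].
by rewrite evMXn mulrA exprSr mulrA PE // [evM P m * _]mulrC mulfV.
Qed.

(** These coordinate equations define the slice for n >= 2. *)
Lemma is_frame1 m : is_frame m 1%:M <->
  (forall i l, tens m ord0 (lift ord_max i) l = (l == lift ord0 i)%:R) /\
  (forall j, \sum_l trL m 0 l * tens m ord0 j l = trR m 0 j).
Proof.
have LE j l : (Lb m ord0 *m col j 1%:M) l 0 = tens m ord0 j l.
  by rewrite col1 -colE !mxE.
have BE j : (trL m *m Lb m ord0) 0 j = \sum_l trL m 0 l * tens m ord0 j l.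
  by rewrite [LHS]mxE; apply: eq_bigr => l _; rewrite [Lb _ _ _ _]mxE.
rewrite /is_frame !col1 Lmx_delta; split=> [[frB frL]|[frL frB]].
  split=> [i l|j]; last by rewrite -BE frB.
  by rewrite -LE frL col1 mxE eqxx andbT.
split=> [|i]; first by apply/matrixP => z j; rewrite ord1 BE.
by apply/matrixP => l z; rewrite ord1 LE frL col1 mxE eqxx andbT.
Qed.

End Frame.

(** * A polynomial retraction onto the slice, and a point of the slice in the domain *)

Section Retraction.

Variables (k : fieldType) (N : nat).
Local Notation n := N.+2.
Local Notation h := (ord_max : 'I_n).
Local Notation i1 := (lift ord0 ord0 : 'I_n).
Implicit Types (m : tensM k n).

Definition addt m (f : 'I_n -> 'I_n -> 'I_n -> k) : tensM k n :=
  TensM (fun i j l => tens m i j l + f i j l).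

Lemma trL_addt m f i : trL (addt m f) 0 i = trL m 0 i + \sum_j f i j j.
Proof. by rewrite !mxE -big_split; apply: eq_bigr => j _; rewrite !mxE. Qed.

Lemma trR_addt m f j : trR (addt m f) 0 j = trR m 0 j + \sum_i f i j i.
Proof. by rewrite !mxE -big_split; apply: eq_bigr => i _; rewrite !mxE. Qed.

Definition retract1 m : tensM k n := TensM (fun i j l =>
  if i == ord0 then (if unlift h j is Some j' then (l == lift ord0 j')%:R else tens m i j l)
  else tens m i j l).

(** The error in trL (e_0 e_h) = trR e_h, with trL e_(l+1) already replaced by trR e_l, the value it
    receives in [retract3]. *)
Definition defect_h m :=
  tens m ord0 h ord0 * trL m 0 ord0
  + \sum_(l < N.+1) tens m ord0 h (lift ord0 l) * trR m 0 (lift h l) - trR m 0 h.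

(* The coordinate [(i1, h, i1)] enters no entry of [trR] but [trR _ 0 h], and not
   [trL _ 0 0]; it may enter [trL _ 0 i1], which [retract3] adjusts afterwards. *)
Definition retract2 m : tensM k n :=
  addt m (fun i j l => ((i == i1) && (j == h) && (l == i1))%:R * defect_h m).

Definition defect m (i : 'I_n) :=
  if unlift ord0 i is Some i' then trR m 0 (lift h i') - trL m 0 i else 0.

(** For i > 0 the coordinate (i, 0, 0) enters trL e_i with coefficient 1 and enters no entry of trR,
    so each equation trL e_i = trR e_(i-1) can be corrected independently. *)
Definition retract3 m : tensM k n :=
  addt m (fun i j l => ((j == ord0) && (l == ord0))%:R * defect m i).

Definition retract m := retract3 (retract2 (retract1 m)).

Lemma trL_retract2 m : trL (retract2 m) 0 ord0 = trL m 0 ord0.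
Proof.
by rewrite trL_addt big1 ?addr0 // => j _; rewrite mul0r.
Qed.

Lemma trR_retract2 m j : trR (retract2 m) 0 j = trR m 0 j + (j == h)%:R * defect_h m.
Proof.
rewrite trR_addt (bigD1 i1) //= big1 ?addr0 ?eqxx ?andbT // => i /negbTE ne_i.
by rewrite ne_i mul0r.
Qed.

Lemma trL_retract3 m i : trL (retract3 m) 0 i = trL m 0 i + defect m i.
Proof.
rewrite trL_addt (bigD1 ord0) //= mul1r big1 ?addr0 // => j /negbTE ne_j.
by rewrite ne_j mul0r.
Qed.

Lemma defect0 m : defect m ord0 = 0.
Proof. by rewrite /defect unlift_none. Qed.

Lemma trR_retract3 m j : trR (retract3 m) 0 j = trR m 0 j.
Proof.
rewrite trR_addt big1 ?addr0 // => i _.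
have [->|/negbTE ne_i] := eqVneq i ord0; first by rewrite defect0 mulr0.
by rewrite andbF mul0r.
Qed.

Lemma tens_retract0 m j l : tens (retract m) ord0 j l = tens (retract1 m) ord0 j l.
Proof. by rewrite [LHS]/= defect0 mulr0 mul0r !addr0. Qed.

(** The later corrections leave the products e_0 e_j and the value trL e_0 alone, and [retract3]
    preserves trR. Given e_0 e_i = e_(i+1), the trace equation at i < h reads trL e_(i+1) = trR e_i,
    which [retract3] enforces; the one at h was prepared by [retract2]. *)
Lemma retract_frame m : is_frame (retract m) 1%:M.
Proof.
have retract_lift i l : tens (retract m) ord0 (lift h i) l = (l == lift ord0 i)%:R.
  by rewrite tens_retract0 /= liftK.
have ne_h i : (lift h i == h) = false by rewrite eq_sym (negbTE (neq_lift _ _)).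
have trL0 : trL (retract m) 0 ord0 = trL (retract1 m) 0 ord0.
  by rewrite trL_retract3 defect0 addr0 trL_retract2.
have trR_lift i : trR (retract m) 0 (lift h i) = trR (retract1 m) 0 (lift h i).
  by rewrite trR_retract3 trR_retract2 ne_h mul0r addr0.
have trL_lift i : trL (retract m) 0 (lift ord0 i) = trR (retract m) 0 (lift h i).
  by rewrite trL_retract3 trR_retract3 /defect liftK addrC subrK.
apply/is_frame1; split=> // j; case: (unliftP h j) => [i|] ->.
  rewrite (bigD1 (lift ord0 i)) // big1 => [|l /negbTE ne_l].
    by rewrite [LHS]addr0 retract_lift eqxx mulr1 trL_lift.
  by rewrite retract_lift ne_l mulr0.
rewrite big_ord_recl trL0 tens_retract0 trR_retract3 trR_retract2 eqxx mul1r.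
rewrite [RHS]addrC subrK mulrC; congr (_ + _); apply: eq_bigr => l _.
by rewrite trL_lift trR_lift tens_retract0 mulrC.
Qed.

(** On the slice the values prescribed by [retract1] already hold, and both defects vanish. *)
Lemma retract_id m : is_frame m 1%:M -> retract m = m.
Proof.
move=> /is_frame1[m_lift frB].
have retract1_id : retract1 m = m.
  apply: tensP => i j l /=; case: eqP => // ->.
  by case: unliftP => // j' ->; rewrite m_lift.
have trL_lift i : trL m 0 (lift ord0 i) = trR m 0 (lift h i).
  rewrite -frB (bigD1 (lift ord0 i)) //= m_lift eqxx mulr1 big1 ?addr0 //.
  by move=> l /negbTE ne_l; rewrite m_lift ne_l mulr0.
have retract2_id : retract2 m = m.
  apply: tensP => i j l /=; rewrite (_ : defect_h m = 0) ?mulr0 ?addr0 //.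
  rewrite /defect_h -frB [X in _ - X]big_ord_recl mulrC.
  under eq_bigr => l' _ do rewrite -trL_lift mulrC.
  exact: subrr.
rewrite /retract retract1_id retract2_id; apply: tensP => i j l /=.
rewrite (_ : defect m i = 0) ?mulr0 ?addr0 // /defect.
by case: unliftP => // i' ->; rewrite trL_lift subrr.
Qed.

Lemma retract_regular d i j l : regular d (fun m => tens (retract m) i j l).
Proof.
have r1 a b c : regular d (fun m => tens (retract1 m) a b c).
  rewrite /retract1 /=; case: (a == ord0); last exact: regular_tens.
  by case: (unlift h b) => [b'|]; [apply: regular_const | apply: regular_tens].
have r2 a b c : regular d (fun m => tens (retract2 (retract1 m)) a b c).
  apply: regularD; first exact: r1.
  apply: regularM; first exact: regular_const.
  apply: regularB; last by apply: (regular_trR r1).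
  apply: regularD; first by apply: regularM; [apply: r1 | apply: (regular_trL r1)].
  by apply: regular_sum => e; apply: regularM; [apply: r1 | apply: (regular_trR r1)].
apply: regularD; first exact: r2.
apply: regularM; first exact: regular_const.
rewrite /defect; case: (unlift ord0 i) => [i'|]; last exact: regular_const.
by apply: regularB; [apply: (regular_trR r2) | apply: (regular_trL r2)].
Qed.

(* An algebra on the slice with nondegenerate trace form: [e_0 e_i = e_(i+1)]
   and [e_0 e_h = - e_0], where [h = n - 1]; for [i, j > 0] the product
   [e_i e_j] is [e_1] if [i + j = n] and [0] otherwise; the products [e_i e_0]
   are then chosen so that [trL = e_1^*] and [trR = e_0^*]. *)
Definition slice_point : tensM k n := TensM (fun i j l =>
  if i == ord0 then (if j == h then - (l == ord0)%:R else (l == j.+1 :> nat)%:R)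
  else (l == i1)%:R * ((i + j == n) || ((i == i1) && (j == ord0)))%N%:R
    + ((j == ord0) && (l == ord0))%:R * ((i == i1)%:R - (i == h)%:R)).

Lemma trL_slice_point i : trL slice_point 0 i = (i == i1)%:R.
Proof.
rewrite mxE; have [->|i_neq0] := eqVneq i ord0.
  rewrite [LHS]big1 // => j _; rewrite mxE /=.
  have [->|_] := eqVneq j h; first by rewrite oppr0.
  by rewrite ltn_eqF.
(* For i > 0 only e_i e_0 and e_i e_1 contribute to the trace: the first gives [i = 1] - [i = h],
   the second [i = h]. *)
rewrite [LHS](bigD1 ord0) //= (bigD1 i1) //= big1 => [|j /andP[/negbTE j0 /negbTE j1]]; last first.
  by rewrite mxE /= (negbTE i_neq0) j0 j1 !mul0r addr0.
rewrite !mxE /= (negbTE i_neq0) !mul0r !mul1r add0r !addr0 andbF orbF addn1 eqSS.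
by rewrite -val_eqE /= subrK.
Qed.

Lemma trR_slice_point j : trR slice_point 0 j = (j == ord0)%:R.
Proof.
(* Only e_0 e_j and e_1 e_j contribute: the first gives -[j = h], the second [j = h] + [j = 0]. *)
rewrite mxE [LHS](bigD1 ord0) //= (bigD1 i1) //=.
rewrite big1 => [|i /andP[/negbTE i0 /negbTE i1']]; last first.
  by rewrite mxE /= i0 i1' !mul0r andbF mul0r addr0.
rewrite !mxE /= !andbF mul0r mul1r !addr0 add1n eqSS.
have [->|j_neqh] := eqVneq j h; first by rewrite eqxx /= addNr.
by rewrite -(inj_eq val_inj) /= in j_neqh; rewrite (negbTE j_neqh) /= add0r.
Qed.

Lemma slice_point_frame : is_frame slice_point 1%:M.
Proof.
apply/is_frame1; split=> [i l|j] /=.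
  have /negbTE-> : lift h i != h by rewrite eq_sym neq_lift.
  by rewrite /bump leqNgt ltn_ord add0n.
rewrite (bigD1 i1) //= trL_slice_point trR_slice_point eqxx mul1r big1 ?addr0.
  have [->|_] := eqVneq j h; first by rewrite oppr0.
  by rewrite /bump add1n eqSS eq_sym.
by move=> l /negbTE ne_l; rewrite trL_slice_point ne_l mul0r.
Qed.

Lemma slice_point_trace_form : trace_form slice_point \in unitmx.
Proof.
have BE i j : trace_form slice_point i j = tens slice_point i j i1.
  rewrite mxE mxE (bigD1 i1) //= trL_slice_point eqxx mul1r big1 ?addr0 ?mxE //.
  by move=> l /negbTE ne_l; rewrite trL_slice_point ne_l mul0r.
rewrite -row_free_unit -kermx_eq0; apply/rowV0P => u /sub_kermxP uB.
(* As trL = e_1^*, the form reads off the e_1-coefficient of e_i e_j. For i > 0 its column n - i has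
   a single nonzero entry, a 1 in row i, so [u] vanishes at i. Column 0 then handles the entry at
   0. *)
have u_neq0 i : i != ord0 -> u 0 i = 0.
  move=> i_neq0; have i_gt0 : (0 < i)%N by rewrite lt0n.
  have lt_ni : (n - i < n)%N by rewrite ltn_subrL i_gt0.
  pose j : 'I_n := Ordinal lt_ni.
  have j_neq0 : (j == ord0) = false by rewrite -val_eqE /= subn_eq0 leqNgt ltn_ord.
  have := congr1 (fun C : 'rV_n => C 0 j) uB; rewrite [RHS]mxE mxE (bigD1 i) //= BE /=.
  rewrite (negbTE i_neq0) j_neq0 /= subnKC 1?ltnW // eqxx !mul1r mul0r addr0 mulr1.
  rewrite big1 ?addr0 // => a ne_a; rewrite BE /=.
  have [_|a_neq0] := eqVneq a ord0.
    have [_|_] := eqVneq j h; first by rewrite oppr0 mulr0.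
    by rewrite /bump add1n eqSS eq_sym subn_eq0 leqNgt ltn_ord mulr0.
  rewrite j_neq0 andbF orbF mul0r addr0 mul1r.
  have := eqn_add2r (n - i) a i.
  by rewrite subnKC 1?ltnW // val_eqE (negbTE ne_a) => ->; rewrite mulr0.
apply/rowP => i; rewrite mxE; have [->|/u_neq0 //] := eqVneq i ord0.
have := congr1 (fun C : 'rV_n => C 0 ord0) uB; rewrite [RHS]mxE mxE (bigD1 ord0) //= BE /=.
rewrite mulr1 big1 ?addr0 // => a /u_neq0 ->; exact: mul0r.
Qed.

End Retraction.

(** * The cases n = 0, n = 1 and n >= 2 *)

Lemma normal_form0 (k : closedFieldType) : normal_form k 0.
Proof.
(* The space is a single point and the group is trivial: there are no equations, and the domain is
   everything. *)
apply: (@slice_normal_form k 0 void (fun _ _ => 0) 1 (fun=> 1%:M) id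
  (TensM (fun _ _ _ => 0))) => //.
- by case.
- by rewrite evM1 oner_neq0.
- by move=> *; rewrite evM1 oner_neq0.
- by case.
- by case.
- by move=> *; rewrite unitmx1.
- by move=> m g _ _ _; rewrite [g]flatmx0 [RHS]flatmx0.
Qed.

Lemma normal_form1 (k : closedFieldType) : normal_form k 1.
Proof.
have act1 (g : 'M[k]_1) (m : tensM k 1) : g \in unitmx ->
    tens (actM g m) 0 0 0 = tens m 0 0 0 / g 0 0.
  rewrite unitmxE det_mx11 unitfE => g_neq0.
  rewrite /= !big_ord1 [g]mx11_scalar invmx_scalar !mxE /= !mulr1n.
  by rewrite [_ * tens _ _ _ _]mulrC mulfK.
pose d : polyM k 1 := 'X_(enum_rank ((0, 0, 0) : idxM 1)).
have dE m : evM d m = tens m 0 0 0 by rewrite evM_tens.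
have tens_1 (m m' : tensM k 1) : tens m 0 0 0 = tens m' 0 0 0 -> m = m'.
  by move=> eqm; apply: tensP => i j l; rewrite (ord1 i) (ord1 j) (ord1 l).
pose e : tensM k 1 := TensM (fun _ _ _ => 1).
(* As [g] divides the only coordinate by its scalar entry, a nonzero structure is moved to 1 exactly
   by the scalar equal to its coordinate. *)
apply: (@slice_normal_form k 1 unit (fun _ m => tens m 0 0 0 - 1) d
  (fun m => (tens m 0 0 0)%:M) (fun=> e) e).
- by move=> _; apply: regularB; [apply: regular_tens | apply: regular_const].
- by move=> i j l; apply: regular_const.
- by move=> m _; rewrite /= subrr.
- by move=> m /(_ tt)/eqP; rewrite subr_eq0 => /eqP m1; apply: tens_1; rewrite m1.
- by move=> _; rewrite /= subrr.
- by rewrite dE oner_neq0.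
- move=> g m g_unit; rewrite !dE act1 // => m_neq0.
  by rewrite mulf_neq0 // invr_eq0 -unitfE -det_mx11 -unitmxE.
- by move=> i j; apply: eq_regular (regular_tens d 0 0 0) => m _; rewrite !ord1 mxE.
- move=> i j; apply: eq_regular (regular_inv_den d) => m _.
  by rewrite invmx_scalar !ord1 mxE dE.
- by move=> m; rewrite dE unitmxE det_scalar1 unitfE.
- move=> m; rewrite dE => m_neq0 _; rewrite act1.
    by rewrite mxE mulr1n divff // subrr.
  by rewrite unitmxE det_scalar1 unitfE.
- move=> m g _ g_unit /(_ tt)/eqP; rewrite subr_eq0 act1 // => /eqP e1.
  rewrite [g]mx11_scalar; congr (_%:M).
  have g_neq0 : g 0 0 != 0 by rewrite -unitfE -det_mx11 -unitmxE.
  by rewrite -[LHS]mul1r -e1 divfK.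
Qed.

Lemma normal_form_ge2 (k : closedFieldType) (N : nat) : normal_form k N.+2.
Proof.
have [d [dE rK rKV]] := frame_domain k N.
pose F (x : 'I_N.+1 * 'I_N.+2 + 'I_N.+2) (m : tensM k N.+2) : k :=
  match x with
  | inl (i, l) => tens m ord0 (lift ord_max i) l - (l == lift ord0 i)%:R
  | inr j => \sum_l trL m 0 l * tens m ord0 j l - trR m 0 j
  end.
have FP m : is_frame m 1%:M <-> (forall x, F x m = 0).
  rewrite is_frame1; split=> [[frL frB] [[i l]|j] /=|F0].
  - by rewrite frL subrr.
  - by rewrite frB subrr.
  split=> [i l|j]; apply/eqP; rewrite -subr_eq0; apply/eqP.
    exact: (F0 (inl (i, l))).
  exact: (F0 (inr j)).
(* The point [actM g m] lies in the slice exactly when the inverse of [g] is a frame of [m], so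
   existence and uniqueness of [g] become those of the frame. *)
have act_frame m g : g \in unitmx ->
    (forall x, F x (actM g m) = 0) <-> is_frame m (invmx g).
  by move=> g_unit; rewrite -FP is_frame_act // mulmx1.
have s0B := slice_point_trace_form k N; have s0F := slice_point_frame k N.
apply: (@slice_normal_form k N.+2 _ F d (fun m => invmx (frame_mx m)) (@retract k N)
  (slice_point k N)).
- case=> [[i l]|j] /=; apply: regularB; try exact: regular_const.
  * exact: regular_tens.
  * apply: regular_sum => l; apply: regularM; last exact: regular_tens.
    exact: (regular_trL (regular_tens 1)).
  * exact: (regular_trR (regular_tens 1)).
- exact: retract_regular.
- by move=> m; apply/FP/retract_frame.
- by move=> m /FP/retract_id.
- exact/FP.
- by rewrite dE s0B -(frame_mx_uniq s0B s0F) unitmx1.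
- move=> g m g_unit; rewrite !dE => /andP[B_unit K_unit].
  rewrite frame_mx_act // unitmx_mul g_unit K_unit trace_form_act //.
  by rewrite !unitmx_mul unitmx_tr unitmx_inv g_unit B_unit.
- exact: rKV.
- by apply: eq_regular_mx rK => m _; rewrite invmxK.
- by move=> m; rewrite dE unitmx_inv => /andP[].
- move=> m; rewrite dE => /andP[B_unit K_unit].
  by apply/act_frame; rewrite ?unitmx_inv // invmxK; apply: frame_mx_frame.
- move=> m g; rewrite dE => /andP[B_unit _] g_unit /act_frame frg.
  by rewrite -(frame_mx_uniq B_unit (frg g_unit)) invmxK.
Qed.

Theorem theorem2 (k : closedFieldType) (hchar : (2 \in [pchar k]) = false) (n : nat) :
  exists (s t : seq (polyM k n)),
    (forall p, p \in s -> nonconstant p) /\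
    (forall q, q \in t -> nonconstant q) /\
    let S := fun m : tensM k n => forall p, p \in s -> evM p m = 0 in
    let U := fun m : tensM k n => forall q, q \in t -> evM q m != 0 in
    (zirreducible S /\ restriction_iso S) /\
    zdense U /\
    (forall a, U a ->
       exists g : 'M[k]_n, g \in unitmx /\ S (actM g a) /\
         forall g' : 'M[k]_n, g' \in unitmx -> S (actM g' a) -> g' = g).
Proof.
case: n => [|[|N]].
- exact: normal_form0.
- exact: normal_form1.
- exact: normal_form_ge2.
Qed.
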